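(* If $G$ is a $P_5$-free graph (not necessarily connected), then $\gamma_s(G) \le \frac{3}{2}\alpha(G)$.
   Context: All graphs are finite, simple and undirected. $P_n$ denotes the path on $n$ vertices. For a graph $H$, a graph is $H$-free if it has no induced subgraph isomorphic to $H$. A set $S\subseteq V(G)$ is a dominating set of $G$ if every vertex of $V(G)\setminus S$ is adjacent to at least one vertex of $S$. A secure dominating set of $G$ is a dominating set $S$ of $G$ such that for every $v\in V(G)\setminus S$ there is a neighbor $u$ of $v$ in $S$ such that $(S\setminus\{u\})\cup\{v\}$ is a dominating set of $G$. The secure domination number $\gamma_s(G)$ is the minimum cardinality of a secure dominating set of $G$, and the independence number $\alpha(G)$ is the maximum cardinality of an independent set of $G$. *)

(* Defs.v *)
From mathcomp Require Import all_boot all_order all_algebra.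

Set Implicit Arguments.
Unset Strict Implicit.
Unset Printing Implicit Defensive.

Record sgraph := SGraph {
  vertex :> finType;
  adj : rel vertex;
  adj_sym : symmetric adj;
  adj_irr : irreflexive adj }.

Definition graph_iso (G H : sgraph) : Prop :=
  exists2 f : G -> H, bijective f & forall x y, adj (f x) (f y) = adj x y.

Section Induced.
Variables (G : sgraph) (S : {set G}).

Definition induced_adj : rel {x : G | x \in S} :=
  fun x y => adj (val x) (val y).

Fact induced_adj_sym : symmetric induced_adj.
Proof. by move=> x y; apply: adj_sym. Qed.

Fact induced_adj_irr : irreflexive induced_adj.
Proof. by move=> x; apply: adj_irr. Qed.

Definition induced_subgraph : sgraph := SGraph induced_adj_sym induced_adj_irr.
End Induced.

Definition graph_free (H G : sgraph) : Prop :=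
  ~ exists S : {set G}, graph_iso (induced_subgraph S) H.

Section Path.
Variable n : nat.

Definition path_adj : rel 'I_n :=
  fun i j => (i.+1 == j :> nat) || (j.+1 == i :> nat).

Fact path_adj_sym : symmetric path_adj.
Proof. by move=> i j; rewrite /path_adj orbC. Qed.

Fact path_adj_irr : irreflexive path_adj.
Proof. by move=> i; rewrite /path_adj orbb gtn_eqF. Qed.

(* n is the number of vertices, not of edges. *)
Definition path_graph : sgraph := SGraph path_adj_sym path_adj_irr.
End Path.

Section Domination.
Variable G : sgraph.
Implicit Types S A : {set G}.

Definition dominating S : bool :=
  [forall v, (v \notin S) ==> [exists u, (u \in S) && adj v u]].

Definition secure_dominating S : bool :=
  dominating S &&
  [forall v, (v \notin S) ==>
     [exists u, [&& u \in S, adj v u & dominating (v |: (S :\ u))]]].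

Definition independent A : bool :=
  [forall x in A, forall y in A, ~~ adj x y].

Fact secure_dominatingT : secure_dominating [set: G].
Proof. by apply/andP; split; apply/forallP=> v; rewrite inE. Qed.

(* The minimum is genuine: by secure_dominatingT, the default value [set: G]
   is itself a secure dominating set. *)
Definition secure_domination_number : nat :=
  #|[arg min_(S < [set: G] | secure_dominating S) #|S|]|.

Fact secure_domination_numberP :
  (exists2 S, secure_dominating S & #|S| = secure_domination_number) /\
  (forall S, secure_dominating S -> secure_domination_number <= #|S|).
Proof.
rewrite /secure_domination_number.
case: arg_minnP => [|S HS minS]; first exact: secure_dominatingT.
by split; first exists S.
Qed.

(* The default value 0 of the maximum is harmless: set0 is independent. *)
Definition independence_number : nat :=
  \max_(A : {set G} | independent A) #|A|.
End Domination.

(* Main.v *)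
Require Import Defs.
From mathcomp Require Import all_boot all_order all_algebra.
From mathcomp Require Import zify lra.

(** Let [I] be a maximum independent set.  It dominates, and the private
    neighbourhood [private I u] of each [u] in [I] is a clique, since two
    nonadjacent private neighbours of [u] could replace [u] in [I].  Thus [I]
    fails to be secure only at a vertex [v] such that every neighbour [u] of [v]
    in [I] has a private neighbour [w], distinct from [v] and not adjacent to it;
    such a [v] has at least two neighbours in [I].

    The remedy is to add a set [X] of vertices outside [I].  A vertex of [X] can
    leave [I :|: X] freely, because [I] still dominates, so everything adjacent
    to [X] is defended; moreover private neighbours adjacent to [X] no longer
    obstruct the other swaps.  Call [u] in [I] exposed when it is adjacent to a
    vertex that remains undefended.  As long as there is an undefended [v], add
    to [X] one of the private neighbours [w] that witness this, attached to some
    [u1] in [I].  The crux ([add_witness_unexposed]) is that, in a graph without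
    induced [P5], none of the neighbours of [v] in [I] is exposed any longer.
    They are at least two and all were exposed, so each addition removes at least
    two exposed vertices out of at most [#|I|], and the process stops with
    [2 * #|X| <= #|I|].  Then [I :|: X] is secure and has at most [3/2 #|I|]
    vertices. *)

Set Implicit Arguments.
Unset Strict Implicit.
Unset Printing Implicit Defensive.

(** * Induced paths on five vertices *)

(** Distinctness of the five vertices is not asked for: no two vertices of [P5]
    have the same neighbours, so the adjacency pattern already forces it. *)
Lemma P5_free_no_path (G : sgraph) (a b c d e : G) :
  graph_free (path_graph 5) G ->
  adj a b -> adj b c -> adj c d -> adj d e ->
  ~~ adj a c -> ~~ adj a d -> ~~ adj a e ->
  ~~ adj b d -> ~~ adj b e -> ~~ adj c e -> False.
Proof.
move=> HG ab bc cd de ac ad ae bd be ce; apply: HG.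
pose f (i : 'I_5) := nth a [:: a; b; c; d; e] i.
have fadj i j : adj (f i) (f j) = path_adj i j.
  rewrite /path_adj.
  case: i => -[|[|[|[|[|//]]]]] i5; case: j => -[|[|[|[|[|//]]]]] j5;
    rewrite /f /= ?adj_irr //; try exact/negbTE; rewrite adj_sym //;
    exact/negbTE.
have finj : injective f.
  move=> i j eqf.
  have same k : path_adj i k = path_adj j k by rewrite -!fadj eqf.
  move: (same (inord 0)) (same (inord 1)) (same (inord 2)) (same (inord 3))
        (same (inord 4)); rewrite /path_adj !inordK //.
  case: i {eqf same} => -[|[|[|[|[|//]]]]] i5;
    case: j => -[|[|[|[|[|//]]]]] j5 //= *; exact: val_inj.
exists (f @: 'I_5).
have f_im i : f i \in f @: 'I_5 by apply: imset_f.
pose h (i : 'I_5) : induced_subgraph (f @: 'I_5) := exist _ (f i) (f_im i).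
have h_surj (x : induced_subgraph (f @: 'I_5)) : exists i, h i == x.
  by case: x => x x_im; have /imsetP[i _ xi] := x_im; exists i; rewrite -val_eqE /= xi.
pose g x := xchoose (h_surj x).
have gK : cancel g h by move=> x; apply/eqP/(xchooseP (h_surj x)).
have hK : cancel h g by move=> i; apply: finj; have /(congr1 val) := gK (h i).
exists g; first by exists h.
by move=> x y; rewrite -{2}(gK x) -{2}(gK y) [RHS]fadj.
Qed.

(** * Securing a dominating set by extra vertices *)

Section PrivateNeighbours.
Variable G : sgraph.
Implicit Types (I X : {set G}) (u v w : G).

Definition nbrs_in I v : {set G} := [set u in I | adj v u].

Definition private I u : {set G} := [set w in ~: I | nbrs_in I w == [set u]].

Definition far X : {set G} :=
  [set w in ~: X | [forall x in X, ~~ adj w x]].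

Lemma far_setU1 X w y :
  (y \in far (w |: X)) = [&& y != w, ~~ adj y w & y \in far X].
Proof.
rewrite !inE negb_or -andbA; apply/idP/idP.
  case/and3P=> -> yX /forall_inP yf; rewrite yX yf ?setU11 //=.
  by apply/forall_inP=> x xX; apply: yf; rewrite setU1r.
case/and4P=> -> yw -> /forall_inP yf; apply/forall_inP=> x.
by case/setU1P=> [->|/yf].
Qed.

(** The obstruction to defending [v] in [I :|: X] for a dominating [I]: whichever
    neighbour of [v] in [I] moves to [v], some [w] is left undominated.  The vertices
    next to [X] are excluded because a vertex of [X] can always be spared. *)
Definition undefended I X v : bool :=
  [&& v \notin I, v \in far X &
    [forall u in nbrs_in I v,
      [exists w in private I u :&: far X, (w != v) && ~~ adj v w]]].

Definition exposed I X : {set G} :=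
  [set u | [exists v, undefended I X v && (u \in nbrs_in I v)]].

Lemma undefendedP I X v u : undefended I X v -> u \in nbrs_in I v ->
  exists w, [/\ w \in private I u, w \in far X, w != v & ~~ adj v w].
Proof.
case/and3P=> _ _ /forall_inP vP /vP/exists_inP[w /setIP[? ?] /andP[? ?]].
by exists w.
Qed.

Lemma undefended_setU1 I X v w : undefended I (w |: X) v -> undefended I X v.
Proof.
case/and3P=> vI; rewrite far_setU1 => /and3P[_ _ vX] /forall_inP vP.
rewrite /undefended vI vX; apply/forall_inP=> u /vP/exists_inP[y].
rewrite inE far_setU1 => /and4P[yu _ _ yX] yv.
by apply/exists_inP; exists y; rewrite // inE yu.
Qed.

Lemma exposed_setU1 I X w : exposed I (w |: X) \subset exposed I X.
Proof.
apply/subsetP=> u; rewrite !inE => /existsP[v /andP[/undefended_setU1 vb uv]].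
by apply/existsP; exists v; rewrite vb.
Qed.

Lemma private_notin I u w : w \in private I u -> w \notin I.
Proof. by rewrite !inE => /andP[]. Qed.

Lemma private_adj I u w x : w \in private I u -> x \in I -> adj w x = (x == u).
Proof.
rewrite inE => /andP[_ /eqP/setP/(_ x)]; rewrite !inE => E xI.
by rewrite -E xI.
Qed.

(** A neighbour [v] of some [x] in [X] is defended by [x], since [I] dominates by
    itself.  Any other [v] has a neighbour [u] in [I] with no obstruction, and
    moving [u] to [v] can only endanger [u] and the private neighbours of [u] that
    are far from [X]. *)
Lemma secure_dominating_setU I X :
  dominating I -> [disjoint I & X] -> (forall v, ~~ undefended I X v) ->
  secure_dominating (I :|: X).
Proof.
move=> /forallP dI dIX good.
have dom v : v \notin I -> exists2 u, u \in I & adj v u.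
  by move=> vI; have /exists_inP[u] := implyP (dI v) vI; exists u.
apply/andP; split; apply/forallP=> v; rewrite inE; apply/implyP=> /norP[vI vX].
  by have [u uI vu] := dom _ vI; apply/exists_inP; exists u; rewrite // inE uI.
have [vf|] := boolP (v \in far X); last first.
  rewrite inE inE vX /= negb_forall_in => /exists_inP[x xX /negPn vx].
  apply/existsP; exists x; rewrite inE xX orbT vx.
  apply/forallP=> y; apply/implyP; rewrite !inE => /norP[_ yS].
  (* [x] is not in [I], so all of [I] is still there after the swap *)
  have keep u : u \in I -> u != x.
    by move=> uI; apply: contraTneq xX => <-; rewrite (disjointFr dIX).
  have [yI|yI] := boolP (y \in I); first by rewrite yI keep in yS.
  have [u uI yu] := dom _ yI; apply/exists_inP; exists u => //.
  by rewrite !inE uI keep // orbT.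
have := good v; rewrite /undefended vI vf /= negb_forall_in.
case/exists_inP=> u uv; rewrite negb_exists_in => /forall_inP ok.
have /andP[uI vu] : (u \in I) && adj v u by move: uv; rewrite inE.
apply/existsP; exists u; rewrite inE uI vu.
apply/forallP=> y; apply/implyP; rewrite !inE => /norP[yv yS].
have [->|yu] := eqVneq y u.
  by apply/exists_inP; exists v; rewrite ?setU11 // adj_sym.
move: yS; rewrite yu /= => /norP[yI yX].
have [/exists_inP[x xX yx]|] := boolP [exists x in X, adj y x].
  apply/exists_inP; exists x => //; rewrite !inE xX orbT andbT.
  by apply/orP; right; apply: contraTneq xX => ->; rewrite (disjointFr dIX).
rewrite negb_exists_in => yf.
have [/exists_inP[z zI /andP[zu yz]]|] :=
    boolP [exists z in I, (z != u) && adj y z].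
  by apply/exists_inP; exists z; rewrite // !inE zI zu orbT.
rewrite negb_exists_in => /forall_inP yu'.
have yp : y \in private I u.
  have only z : z \in I -> adj y z -> z = u.
    by move=> zI yz; have := yu' z zI; rewrite yz andbT => /negPn/eqP.
  have [z zI yz] := dom _ yI; have zu := only _ zI yz; subst z.
  rewrite inE inE yI; apply/eqP/setP=> z; rewrite !inE.
  by apply/andP/eqP=> [[zI' /(only _ zI')] //|->].
have := ok y; rewrite inE yp inE inE yX yf yv negbK => /(_ isT) vy.
by apply/exists_inP; exists v; rewrite ?setU11 // adj_sym.
Qed.

End PrivateNeighbours.

(** * Few extra vertices suffice *)

Section MaximumIndependent.
Variables (G : sgraph) (I : {set G}).
Hypothesis indI : independent I.
Hypothesis maxI : forall A : {set G}, independent A -> #|A| <= #|I|.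
Implicit Types (X : {set G}) (u v w : G).

Lemma independent_adjF x y : x \in I -> y \in I -> adj x y = false.
Proof. by move=> xI yI; apply/negbTE/(forall_inP (forall_inP indI x xI)). Qed.

Lemma maximum_dominating : dominating I.
Proof.
apply/forallP=> v; apply/implyP=> vI; apply: contraT => /existsPn vn0.
have vn u : u \in I -> ~~ adj v u by move=> uI; have := vn0 u; rewrite uI.
suff /maxI : independent (v |: I) by rewrite cardsU1 vI ltnn.
apply/forall_inP=> x /setU1P[->|xI]; apply/forall_inP=> y /setU1P[->|yI].
- by rewrite adj_irr.
- exact: vn.
- by rewrite adj_sym vn.
- by rewrite independent_adjF.
Qed.

(** Two nonadjacent private neighbours of [u] could be exchanged for [u]. *)
Lemma private_clique u w1 w2 : u \in I ->
  w1 \in private I u -> w2 \in private I u -> w1 != w2 -> adj w1 w2.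
Proof.
move=> uI w1u w2u ne; apply/negPn/negP=> nadj.
have far_from w x : w \in private I u -> x \in I :\ u -> ~~ adj w x.
  by move=> wu /setD1P[xu xI]; rewrite (private_adj wu).
suff /maxI : independent (w1 |: (w2 |: I :\ u)).
  rewrite !cardsU1 !inE (negPf ne) (negPf (private_notin w1u)).
  by rewrite (negPf (private_notin w2u)) !andbF /= [#|I|](cardsD1 u) uI; lia.
apply/forall_inP=> x; rewrite in_setU1 in_setU1 => /or3P[/eqP->|/eqP->|xI];
  apply/forall_inP=> y; rewrite in_setU1 in_setU1 => /or3P[/eqP->|/eqP->|yI].
- by rewrite adj_irr.
- by [].
- exact: far_from yI.
- by rewrite adj_sym.
- by rewrite adj_irr.
- exact: far_from yI.
- by rewrite adj_sym (far_from _ _ w1u).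
- by rewrite adj_sym (far_from _ _ w2u).
- by move: xI yI; rewrite !inE => /andP[_ xI] /andP[_ yI]; rewrite independent_adjF.
Qed.

(** If [u] were the only neighbour of [v] in [I], then [v] would lie in the clique
    [private I u] and be adjacent to the witness against [u]. *)
Lemma undefended_other_nbr X v u : undefended I X v -> u \in nbrs_in I v ->
  exists2 u', u' \in nbrs_in I v & u' != u.
Proof.
move=> vb uv; have [w [wu _ wv]] := undefendedP vb uv.
move: (uv); rewrite inE => /andP[uI _] nvw.
have [/exists_inP[u' ? ?]|] := boolP [exists u' in nbrs_in I v, u' != u].
  by exists u'.
rewrite negb_exists_in => /forall_inP only.
case/negP: nvw; apply: (private_clique uI _ wu); last by rewrite eq_sym.
have /and3P[vI _ _] := vb; rewrite inE inE vI eqEsubset sub1set uv andbT.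
by apply/subsetP=> z /only; rewrite negbK inE.
Qed.

Hypothesis HG : graph_free (path_graph 5) G.

(** Otherwise [w1 - u1 - v - u2 - w2] is an induced path. *)
Lemma private_nonnbrs_adj v u1 u2 w1 w2 :
  u1 \in nbrs_in I v -> u2 \in nbrs_in I v -> u1 != u2 ->
  w1 \in private I u1 -> w2 \in private I u2 ->
  ~~ adj v w1 -> ~~ adj v w2 -> adj w1 w2.
Proof.
rewrite inE => /andP[u1I vu1]; rewrite inE => /andP[u2I vu2] ne w1u w2u n1 n2.
apply/negPn/negP=> nadj.
have u1v : adj u1 v by rewrite adj_sym.
have w1v : ~~ adj w1 v by rewrite adj_sym.
have w1_nbr := private_adj w1u; have w2_nbr := private_adj w2u.
apply: (P5_free_no_path (a := w1) HG _ u1v vu2 _ w1v _ nadj _ _ n2).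
- by rewrite w1_nbr.
- by rewrite adj_sym w2_nbr.
- by rewrite w1_nbr // eq_sym.
- by rewrite independent_adjF.
- by rewrite adj_sym w2_nbr.
Qed.

(** Suppose that some [u2] adjacent to [v] is still exposed, through an undefended
    [v'].  For [u2 = u1] this contradicts the clique [private I u1], which
    contains [w], so that none of it is far from [w].  Otherwise [v] gives [w2] in [private I u2]
    adjacent to [w], and [v'] gives adjacent vertices [w'] in [private I u2] and
    [w3] in [private I u3], neither of them adjacent to [w], where [u3] differs
    from [u1] and [u2].  If [w2] and [w3] are adjacent, [u1 - w - w2 - w3 - u3] is
    an induced path, and otherwise [u1 - w - w2 - w' - w3] is. *)
Lemma add_witness_unexposed X v u1 w u2 :
  undefended I X v -> u1 \in nbrs_in I v ->
  w \in private I u1 -> ~~ adj v w ->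
  u2 \in nbrs_in I v -> u2 \notin exposed I (w |: X).
Proof.
move=> vb u1v wu1 nvw u2v; rewrite inE; apply/existsP=> -[v' /andP[v'b u2v']].
have u1I : u1 \in I by move: u1v; rewrite inE => /andP[].
have u2I : u2 \in I by move: u2v; rewrite inE => /andP[].
have not_u1 u : u \in nbrs_in I v' -> u1 != u.
  move=> uv'; apply/eqP=> E; subst u.
  have [y [yu1]] := undefendedP v'b uv'; rewrite far_setU1.
  by case/and3P=> yw /negP[]; apply: private_clique yu1 wu1 yw.
have [w' [w'u2 w'f _ nv'w']] := undefendedP v'b u2v'.
have [u3 u3v' u32] := undefended_other_nbr v'b u2v'.
have [w3 [w3u3 w3f _ nv'w3]] := undefendedP v'b u3v'.
have u3I : u3 \in I by move: u3v'; rewrite inE => /andP[].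
have [w2 [w2u2 _ _ nvw2]] := undefendedP vb u2v.
move: w'f w3f; rewrite !far_setU1 => /and3P[_ w'w _] /and3P[_ w3w _].
have u12 := not_u1 _ u2v'; have u13 := not_u1 _ u3v'.
have ww2 := private_nonnbrs_adj u1v u2v u12 wu1 w2u2 nvw nvw2.
have w'w3 : adj w' w3.
  by rewrite (private_nonnbrs_adj u2v' u3v' _ w'u2 w3u3) // eq_sym.
have w2w' : adj w2 w'.
  apply: (private_clique u2I w2u2 w'u2).
  by apply: contraNneq w'w => <-; rewrite adj_sym.
have u1w : adj u1 w by rewrite adj_sym (private_adj wu1).
have w_w' : ~~ adj w w' by rewrite adj_sym.
have w_w3 : ~~ adj w w3 by rewrite adj_sym.
have u1w2 : ~~ adj u1 w2 by rewrite adj_sym (private_adj w2u2).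
have u1w3 : ~~ adj u1 w3 by rewrite adj_sym (private_adj w3u3).
have [w23|nw23] := boolP (adj w2 w3).
- apply: (P5_free_no_path (e := u3) HG u1w ww2 w23 _ u1w2 u1w3 _ w_w3).
  + by rewrite (private_adj w3u3).
  + by rewrite independent_adjF.
  + by rewrite (private_adj wu1) // eq_sym.
  + by rewrite (private_adj w2u2).
- apply: (P5_free_no_path HG u1w ww2 w2w' w'w3 u1w2 _ u1w3 w_w' w_w3 nw23).
  by rewrite adj_sym (private_adj w'u2).
Qed.

(** Each vertex added to [X] costs 2 in the budget [#|I|] and is paid for by two
    vertices that cease to be exposed; so a set [X] within the budget that has the
    fewest exposed vertices leaves nothing undefended. *)
Lemma exists_defending_set : exists X,
  [/\ [disjoint I & X], forall v, ~~ undefended I X v & 2 * #|X| <= #|I|].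
Proof.
pose affordable X := [disjoint I & X] && (2 * #|X| + #|exposed I X| <= #|I|).
have aff0 : affordable set0.
  rewrite /affordable disjoint_sym disjoints_subset sub0set cards0 /=.
  apply/subset_leq_card/subsetP=> u.
  by rewrite inE => /existsP[v /andP[_]]; rewrite inE => /andP[].
case: (arg_minnP (fun X => #|exposed I X|) aff0) => X /andP[dX cX] minX.
exists X; split=> // [v|]; last by apply: leq_trans cX; rewrite leq_addr.
apply/negP=> vb; have /and3P[vI _ _] := vb.
have /exists_inP[u uI vu] := implyP (forallP maximum_dominating v) vI.
have uv : u \in nbrs_in I v by rewrite inE uI.
have [w [wu wf wv nvw]] := undefendedP vb uv.
have [u' u'v ne] := undefended_other_nbr vb uv.
have exposed_nbr x : x \in nbrs_in I v -> x \in exposed I X.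
  by move=> xv; rewrite inE; apply/existsP; exists v; rewrite vb.
have wX : w \notin X by move: wf; rewrite !inE => /andP[].
have drop2 : #|exposed I (w |: X)| + 2 <= #|exposed I X|.
  rewrite (cardsD1 u (exposed I X)) (cardsD1 u' (exposed I X :\ u)) in_setD1 ne.
  rewrite !exposed_nbr //= addn2 !add1n !ltnS.
  apply/subset_leq_card/subsetP=> x xe.
  have gone y : y \in nbrs_in I v -> x != y.
    move=> yv; apply: contraTneq xe => ->.
    exact: (add_witness_unexposed vb uv wu nvw yv).
  rewrite !in_setD1 (gone _ uv) (gone _ u'v) /=.
  exact: (subsetP (exposed_setU1 _ _ _) _ xe).
have /minX : affordable (w |: X).
  rewrite /affordable cardsU1 wX disjoint_sym disjoints_subset subUset sub1set.
  rewrite inE (private_notin wu) -disjoints_subset disjoint_sym dX.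
  apply: leq_trans cX; rewrite mulnDr addnAC addnC leq_add2l.
  by rewrite [2 * _ + _]addnC.
by rewrite leqNgt (leq_trans _ drop2) // addn2.
Qed.

End MaximumIndependent.

Theorem theorem5 (G : sgraph) (HG : graph_free (path_graph 5) G) :
  ((secure_domination_number G)%:R <=
     (3%:R / 2%:R) * (independence_number G)%:R :> rat)%R.
Proof.
have ind0 : independent (set0 : {set G}).
  by apply/forall_inP=> x; rewrite inE.
have [|I indI cardI] := @eq_bigmax_cond _ (@independent G) (fun A => #|A|).
  by apply/card_gt0P; exists set0.
have {}cardI : independence_number G = #|I| := cardI.
have maxI (A : {set G}) : independent A -> #|A| <= #|I|.
  by move=> indA; rewrite -cardI; exact: (@leq_bigmax_cond _ (@independent G) (fun B => #|B|)).
have [X [dX good cX]] := exists_defending_set indI maxI HG.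
have sec := secure_dominating_setU (maximum_dominating indI maxI) dX good.
have := (secure_domination_numberP G).2 _ sec => leS.
have {cX} : 2 * secure_domination_number G <= 3 * independence_number G.
  rewrite cardI.
  apply: leq_trans (leq_mul (leqnn 2) leS) _.
  apply: leq_trans (leq_mul (leqnn 2) (leq_card_setU I X)) _.
  by rewrite mulnDr (mulnDl 2 1) mul1n leq_add2l.
rewrite -(Num.Theory.ler_nat rat) !GRing.natrM; lra.
Qed.
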